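(* Let $p_1,p_2,\ldots\in[0,1]$ and let $P_i(N)$, $A_i(N)$, $Q_i$ be the probabilities defined in the context. For every integer $i>1$ and every integer $N\ge 0$, $$P_i(N)=Q_{i-1}P_{i-1}(N)+A_i(N)\,p_i\prod_{l=1}^{i-1}(1-p_l)+p_i\prod_{l=1}^{i-1}(1-p_l)\sum_{j=1}^{i-1}\left[2^{j-1}P_j(N)\prod_{\substack{1\le \ell\le i-1\\ \ell\ne j}}Q_\ell\right],$$ and moreover $P_1(0)=p_1$ and $P_1(N)=0$ for $N>0$.
   Context: $T_i$ is the perfect binary tree with $i$ layers, numbered from the leaves (layer $1$) to the root (layer $i$). Its $2^{i-1}$ leaves carry the data fragments (binary vectors of a fixed length), and every non-leaf vertex carries the bitwise XOR of its two children's fragments. A subset of the vertices is decodable if the fragments at its vertices determine all data fragments (equivalently, the $\mathbb{F}_2$-indicator vectors of the leaf sets below its vertices span $\mathbb{F}_2^{2^{i-1}}$). Vertices in the subset are called present, the others missing. A missing-vertex path is a path in the tree (possibly a single vertex) all of whose vertices are missing. Random model: each vertex of layer $j$ is present with probability $p_j$, independently of all other vertices. Recovery cost: in a decodable subset, a data fragment whose leaf is present is recovered with $0$ communicated fragments. A data fragment whose leaf $y$ is missing is recovered by the (unique) present vertex $x$ such that there is a missing-vertex path from a child of $x$ down to $y$ (that is, the lowest present ancestor of $y$). The number of communicated fragments for this data fragment is the number of present proper descendants $z$ of $x$ such that no vertex strictly between $x$ and $z$ is present. Definitions: $Q_i$ is the probability that the random subset of $T_i$ is decodable. $P_i(N)$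 is the probability that the random subset of $T_i$ is decodable and a particular (fixed) data fragment is recovered with $N$ communicated fragments (by symmetry this does not depend on the choice of data fragment). For $i\ge 2$, $A_i(N)$ is the probability that the random subset of $T_i$ is decodable and a particular data fragment is recovered with $N$ communicated fragments, given that the root is present and that there is a missing-vertex path from a child of the root to the leaf of that data fragment (i.e. the root is declared present, the vertices on that path are declared missing, and every other vertex, if it lies in layer $j$, is present with probability $p_j$, independently of all other vertices). *)

(* Defs.v *)
From HB Require Import structures.
From mathcomp Require Import all_boot all_order all_algebra.

Set Implicit Arguments.
Unset Strict Implicit.
Unset Printing Implicit Defensive.

Import Order.TTheory GRing.Theory Num.Theory.
Local Open Scope ring_scope.

(* A vertex of the perfect binary tree T_i, i >= 1, is the sequence of turns
   (length at most i - 1) leading to it from the root [::]; its children are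
   obtained by appending one turn, and u is an ancestor of v, or v itself, iff
   the sequence u is a prefix of v.  The types are inhabited for i = 0 as well,
   but only i >= 1 is meaningful. *)
Definition vertex (i : nat) : finType := {bseq i.-1 of bool}.
Definition leaf (i : nat) : finType := (i.-1).-tuple bool.

Definition leaf_vertex i (y : leaf i) : vertex i := bseq_of_tuple y.

(* Layer 1 consists of the leaves, layer i of the root. *)
Definition layer i (v : vertex i) : nat := (i - size v)%N.

(* z is a proper descendant of x. *)
Definition below i (x z : vertex i) : bool := (x != z) && prefix x z.

(* Fragments are vectors of length L over F_2, so + is bitwise XOR. *)
Definition fragments i L := {ffun vertex i -> 'rV['F_2]_L}.

(* Every non-leaf vertex carries the XOR of its two children's fragments; for
   a leaf v no vertices l, r as below exist. *)
Definition encoded i L (c : fragments i L) : bool :=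
  [forall v : vertex i, forall l : vertex i, forall r : vertex i,
    (rcons v false == l :> seq bool) && (rcons v true == r :> seq bool) ==>
    (c v == c l + c r)].

(* The fragments at the vertices of S determine all data fragments. *)
Definition decodable i L (S : {set vertex i}) : bool :=
  [forall c : fragments i L, forall c' : fragments i L,
    [&& encoded c, encoded c' & [forall v in S, c v == c' v]] ==>
    [forall y : leaf i, c (leaf_vertex y) == c' (leaf_vertex y)]].

(* The path from the child of x that lies above y down to y consists of the
   proper descendants w of x such that w is y or an ancestor of y. *)
Definition missing_path_below i (S : {set vertex i}) (x y : vertex i) : bool :=
  below x y && [forall w : vertex i, below x w && prefix w y ==> (w \notin S)].

Definition communicated i (S : {set vertex i}) (x : vertex i) : {set vertex i} :=
  [set z in S | below x z & ~~ [exists w in S, below x w && below w z]].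

(* The data fragment of leaf y is recovered with N communicated fragments. *)
Definition recovered_with i (S : {set vertex i}) (y : leaf i) (N : nat) : bool :=
  if leaf_vertex y \in S then N == 0%N
  else [exists x in S, missing_path_below S x (leaf_vertex y)
                       && (#|communicated S x| == N)].

(* Probability of E for the random subset that contains each v with
   probability q v, independently of the other vertices. *)
Definition prob_subset (R : realFieldType) (V : finType) (q : V -> R)
    (E : pred {set V}) : R :=
  \sum_(S : {set V} | E S) \prod_(v : V) (if v \in S then q v else 1 - q v).

Definition layer_law (R : realFieldType) (p : nat -> R) i (v : vertex i) : R :=
  p (layer v).

(* Root declared present, the other vertices above y, and y, declared missing. *)
Definition missing_path_law (R : realFieldType) (p : nat -> R) i (y : leaf i)
    (v : vertex i) : R :=
  if v == [bseq] then 1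
  else if prefix v (leaf_vertex y) then 0
  else p (layer v).

Definition Qprob (R : realFieldType) (L : nat) (p : nat -> R) (i : nat) : R :=
  prob_subset (@layer_law R p i) (fun S => decodable L S).

Definition Pprob (R : realFieldType) (L : nat) (p : nat -> R) (i : nat)
    (y : leaf i) (N : nat) : R :=
  prob_subset (@layer_law R p i)
    (fun S => decodable L S && recovered_with S y N).

Definition Aprob (R : realFieldType) (L : nat) (p : nat -> R) (i : nat)
    (y : leaf i) (N : nat) : R :=
  prob_subset (missing_path_law p y)
    (fun S => decodable L S && recovered_with S y N).

Arguments Pprob {R} L p i y N.
Arguments Aprob {R} L p i y N.

(* Main.v *)
Require Import Defs.
From mathcomp Require Import all_boot all_order all_algebra.
From mathcomp Require Import ring.

Set Implicit Arguments.
Unset Strict Implicit.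
Unset Printing Implicit Defensive.

Import Order.TTheory GRing.Theory Num.Theory.
Local Open Scope ring_scope.

(* Call a subset S of T_i deficient if it is not decodable but becomes so once
   the root is added.  A set is decodable iff both subtrees are decodable, or the
   root is present, one subtree is decodable and the other deficient; it is
   deficient iff the root is missing, one subtree is decodable and the other
   deficient.  So a deficient set has exactly one missing path from the root to a
   leaf, and all subtrees hanging off that path are decodable.

   Let y lie below the child b of the root of T_i.  If both subtrees are decodable
   then y is recovered inside the subtree of b: this is the first term.  Otherwise
   the root is present and a missing path from one of its children to a leaf is
   filled from the root.  If that leaf is y, one gets the A-term; if not, y lies in
   a decodable subtree T_j hanging off that path, which leaves 2^(j-1) choices for
   the leaf, and is recovered inside that T_j. *)

(** * Decodability by recursion on the tree *)

(* Encodings over F_2, as functions of all sequences of turns; only those of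
   length at most n matter. *)
Definition code n (f : seq bool -> 'F_2) :=
  forall s, (size s < n)%N -> f s = f (rcons s false) + f (rcons s true).

Lemma code_eq0 n f : code n f -> (forall y, size y = n -> f y = 0) ->
  forall s, (size s <= n)%N -> f s = 0.
Proof.
move=> cf f0 s les; move: {-1}(n - size s)%N (erefl (n - size s)%N) => k.
elim: k s les => [|k IH] s les ek.
  by apply: f0; apply/eqP; rewrite eqn_leq les -subn_eq0 ek.
have lts : (size s < n)%N by rewrite -subn_gt0 ek.
by rewrite (cf _ lts) !IH ?addr0 ?size_rcons // subnS ek.
Qed.

(** Differences of encodings are encodings, so decodability means a trivial kernel; this can be
    tested coordinatewise, hence on scalar codes, for any positive [L]. *)
Lemma decodableP L n (S : {set vertex n.+1}) : (0 < L)%N ->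
  reflect (forall f, code n f -> (forall v : vertex n.+1, v \in S -> f v = 0) ->
             forall s, (size s <= n)%N -> f s = 0)
          (decodable L S).
Proof.
move=> hL; apply: (iffP idP) => [dS f cf fS|H].
  apply: code_eq0 => // y sy.
  move/forallP/(_ [ffun v : vertex n.+1 => const_mx (f v)]) : dS.
  move/forallP/(_ [ffun=> 0])/implyP => dS.
  have /dS /forallP/(_ (tcast sy (in_tuple y))) : 
    [&& encoded [ffun v : vertex n.+1 => const_mx (m:=1) (n:=L) (f v)],
        encoded (i:=n.+1) (L:=L) [ffun=> 0] &
        [forall v in S, [ffun v : vertex n.+1 => const_mx (m:=1) (n:=L) (f v)] v
                        == [ffun=> 0] v]].
    apply/and3P; split.
    - apply/forallP => v; apply/forallP => l; apply/forallP => r.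
      apply/implyP => /andP[/eqP el /eqP er]; rewrite !ffunE cf -?el -?er.
        by apply/eqP/matrixP => i j; rewrite !mxE.
      by have := size_bseq l; rewrite -el size_rcons.
    - apply/forallP => v; apply/forallP => l; apply/forallP => r.
      by apply/implyP => _; rewrite !ffunE addr0.
    - apply/forall_inP => v vS; rewrite !ffunE fS //.
  rewrite !ffunE /= val_tcast => /eqP/matrixP/(_ ord0 (Ordinal hL)).
  by rewrite !mxE.
apply/forallP => c; apply/forallP => c'; apply/implyP => /and3P[ec ec' eS].
apply/forallP => y; apply/eqP/matrixP => i k.
(* One coordinate of the difference; sequences longer than [n] get a default vertex, which [code n]
   never inspects. *)
pose f s : 'F_2 := (c (insub_bseq n s) - c' (insub_bseq n s)) i k.
have fE (v : vertex n.+1) : f v = (c v - c' v) i k.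
  rewrite /f; congr ((c _ - c' _) _ _); apply: val_inj;
    by rewrite /= /insub_bseq val_insubd size_bseq.
apply/eqP; rewrite -subr_eq0; apply/eqP.
have := H f.
have -> : c (leaf_vertex y) i k - c' (leaf_vertex y) i k = f y.
  by rewrite (fE (leaf_vertex y)) !mxE.
apply; last by rewrite size_tuple.
  move=> s lts.
  have les : (size s <= n)%N by exact: ltnW.
  have lel b : (size (rcons s b) <= n)%N by rewrite size_rcons.
  have enc (d : fragments n.+1 L) : encoded d ->
      d (Bseq les) = d (Bseq (lel false)) + d (Bseq (lel true)).
    move=> /forallP/(_ (Bseq les))/forallP/(_ (Bseq (lel false)))/forallP/(_ (Bseq (lel true))).
    by rewrite /= !eqxx => /eqP.
  rewrite (fE (Bseq les)) (fE (Bseq (lel false))) (fE (Bseq (lel true))).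
  by rewrite !enc // !mxE; ring.
by move=> v vS; rewrite fE (eqP (forall_inP eS v vS)) subrr mxE.
Qed.

(** Prepending a turn embeds the subtree below the root's child [b] into the larger tree; descending
    from a vertex would append the turn instead. *)
Definition child n b (v : vertex n.+1) : vertex n.+2 := cons_bseq b v.
Definition subset_below n b (S : {set vertex n.+2}) : {set vertex n.+1} :=
  [set v | child b v \in S].

Lemma child_neq0 n b (v : vertex n.+1) : (child b v == [bseq]) = false.
Proof. by []. Qed.

Lemma vertexP n (v : vertex n.+2) :
  v = [bseq] \/ exists b w, v = child (n := n) b w.
Proof.
case: v => [[|b s] ss]; first by left; apply: val_inj.
by right; exists b, (Bseq (ss : (size s <= n)%N)); apply: val_inj.
Qed.

Lemma negb_neq b c : c != b -> ~~ b = c.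
Proof. by case: b c => [] []. Qed.

Section Decodable.
Variables (L : nat) (hL : (0 < L)%N).

(** Equivalently, nonzero codes vanishing on [S] exist and all take the value 1 at the root. *)
Definition deficient i (S : {set vertex i}) :=
  decodable L ([bseq] |: S) && ~~ decodable L S.

Lemma decodableW i (S S' : {set vertex i.+1}) :
  S \subset S' -> decodable L S -> decodable L S'.
Proof.
move=> /subsetP sS /(decodableP _ hL) H; apply/decodableP => // f cf fS.
by apply: H => // v /sS; apply: fS.
Qed.

Lemma decodable1 (S : {set vertex 1}) : decodable L S = ([bseq] \in S).
Proof.
apply/(decodableP _ hL)/idP => [H|rS f _ fS [] //= _]; last exact: (fS [bseq]).
apply/negPn/negP => rS; suff /eqP : (1 : 'F_2) = 0 by [].
apply: (H (fun=> 1) _ _ [::]) => // v.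
by rewrite (_ : v = [bseq]) ?(negPf rS) //; apply: val_inj; case: v => [[]].
Qed.

Lemma deficient1 (S : {set vertex 1}) : deficient S = ([bseq] \notin S).
Proof. by rewrite /deficient !decodable1 in_setU1 eqxx. Qed.

Lemma subset_belowU1 n b (S : {set vertex n.+2}) :
  subset_below b ([bseq] |: S) = subset_below b S.
Proof. by apply/setP => v; rewrite !inE child_neq0. Qed.

Definition graft b (a : 'F_2) (f g : seq bool -> 'F_2) (s : seq bool) :=
  if s is c :: s' then (if c == b then f s' else g s') else a.

Lemma code_graft n b a f g : code n f -> code n g -> a = f [::] + g [::] ->
  code n.+1 (graft b a f g).
Proof.
move=> cf cg e [_|c s ss]; first by case: b; rewrite /= e // addrC.
by rewrite /=; case: eqP => _; [apply: cf | apply: cg].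
Qed.

Lemma code_sub n b f : code n.+1 f -> code n (fun s => f (b :: s)).
Proof. by move=> cf s ss; rewrite cf. Qed.

Lemma code_root n b f : code n.+1 f -> f [::] = f [:: b] + f [:: ~~ b].
Proof. by move=> cf; rewrite cf //=; case: b; rewrite // addrC. Qed.

Lemma graft_eq0 n b a (f g : seq bool -> 'F_2) (S : {set vertex n.+2}) :
  ([bseq] \in S -> a = 0) ->
  (forall v : vertex n.+1, v \in subset_below b S -> f v = 0) ->
  (forall v : vertex n.+1, v \in subset_below (~~ b) S -> g v = 0) ->
  forall v : vertex n.+2, v \in S -> graft b a f g v = 0.
Proof.
move=> h0 hf hg v; case: (vertexP v) => [-> //|[c [w ->]]] /= wS.
case: (eqVneq c b) wS => [->|ne] wS; first by apply: hf; rewrite inE.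
by apply: hg; rewrite inE (negb_neq ne).
Qed.

Lemma sub_eq0 n b (f : seq bool -> 'F_2) (S : {set vertex n.+2}) :
  (forall v : vertex n.+2, v \in S -> f v = 0) ->
  forall v : vertex n.+1, v \in subset_below b S -> f (b :: v) = 0.
Proof. by move=> h v; rewrite inE => /h. Qed.

Lemma decodable_sub_eq0 n b f (S : {set vertex n.+2}) :
  code n.+1 f -> (forall v : vertex n.+2, v \in S -> f v = 0) ->
  decodable L (subset_below b S) ->
  forall s, (size s <= n)%N -> f (b :: s) = 0.
Proof.
move=> cf fS /(decodableP _ hL); apply; first exact: code_sub.
exact: (sub_eq0 fS).
Qed.

Lemma eq0_sub n b f : (forall s, (size s <= n)%N -> f (b :: s) = 0 :> 'F_2) ->
  (forall s, (size s <= n)%N -> f (~~ b :: s) = 0) -> code n.+1 f ->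
  forall s, (size s <= n.+1)%N -> f s = 0.
Proof.
move=> h1 h2 cf [_|c s ss]; first by rewrite (code_root b cf) h1 // h2 // addr0.
case: (eqVneq c b) ss => [-> /h1 //|ne ss].
by rewrite -(negb_neq ne) h2.
Qed.

Lemma F2_add1 (a b : 'F_2) : a != 0 -> b != 0 -> a + b = 0.
Proof. by case: a b => [[|[|]]] // ? [[|[|]]] // ? _ _; apply: val_inj. Qed.

(** A missing root imposes no equation, so the kernels of the two subtrees are independent of each
    other. *)
Lemma decodable_root_missing n b (S : {set vertex n.+2}) : [bseq] \notin S ->
  decodable L S = decodable L (subset_below b S) && decodable L (subset_below (~~ b) S).
Proof.
move=> rS; apply/idP/andP => [|[D1 D2]].
  move=> /(decodableP _ hL) H.
  have dec c : decodable L (subset_below c S).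
    apply/decodableP => // f cf fS s ss.
    (* The code is zero on the other subtree, and the root takes the value [f [::]], which is free
       because the root is missing. *)
    have := H (graft c (f [::]) f (fun=> 0)) _ _ (c :: s).
    rewrite /= eqxx; apply => //.
      by apply: code_graft; rewrite ?addr0 // => ? _; rewrite addr0.
    by apply: graft_eq0 => //; rewrite (negPf rS).
  by split.
apply/decodableP => // f cf fS; apply: (eq0_sub (b := b)) => //.
  exact: decodable_sub_eq0 D1.
exact: decodable_sub_eq0 D2.
Qed.

(** A present root forces equal values at its two children, so one decodable subtree supplies the
    root of the other. If neither were decodable, two kernel codes with value 1 at the subtree roots
    would glue. *)
Lemma decodable_root_present n b (S : {set vertex n.+2}) : [bseq] \in S ->
  decodable L S =
    (decodable L (subset_below b S) && decodable L ([bseq] |: subset_below (~~ b) S)) ||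
    (decodable L ([bseq] |: subset_below b S) && decodable L (subset_below (~~ b) S)).
Proof.
move=> rS; apply/idP/idP; last first.
  have dec c : decodable L (subset_below c S) ->
     decodable L ([bseq] |: subset_below (~~ c) S) -> decodable L S.
    move=> D1 /(decodableP _ hL) D2; apply/decodableP => // f cf fS.
    have z1 := decodable_sub_eq0 cf fS D1.
    apply: (eq0_sub (b := c)) => //; apply: D2; first exact: code_sub.
    move=> v; rewrite in_setU1 => /orP[/eqP ->|]; last exact: (sub_eq0 fS).
    by have := code_root c cf; rewrite (fS _ rS) z1 // add0r.
  by case/orP => /andP[]; [apply: dec | move=> D1 D2; apply: (dec (~~ b)); rewrite ?negbK].
move=> /(decodableP _ hL) H.
(* A code of a subtree that vanishes at its root extends by zero to the whole tree. *)
have D1 c : decodable L ([bseq] |: subset_below c S).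
  apply/decodableP => // f cf fS s ss.
  have f0 : f [::] = 0 by rewrite (fS [bseq]) // setU11.
  have := H (graft c 0 f (fun=> 0)) _ _ (c :: s).
  rewrite /= eqxx; apply => //.
    by apply: code_graft; rewrite ?f0 ?addr0 // => ? _; rewrite addr0.
  by apply: graft_eq0 => // v vS; rewrite fS // setU1r.
rewrite !D1 andbT /=; apply/negPn/negP; rewrite negb_or => /andP[/negP N1 /negP N2].
apply: N1; apply/decodableP => // f cf fS.
have [f0|f0] := eqVneq (f [::]) 0.
  have /(decodableP _ hL) := D1 b; apply => // v.
  by rewrite in_setU1 => /orP[/eqP -> //|]; apply: fS.
case: N2; apply/decodableP => // g cg gS.
have [g0|g0] := eqVneq (g [::]) 0.
  have /(decodableP _ hL) := D1 (~~ b); apply => // v.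
  by rewrite in_setU1 => /orP[/eqP -> //|]; apply: gS.
(* Both codes are 1 at their roots, so the whole root gets 1 + 1 = 0 and the glued code vanishes on
   [S]. *)
have := H (graft b 0 f g) _ _ [:: b]; rewrite /= eqxx => /(_ _ _ isT) e.
have : f [::] = 0.
  by apply: e; [apply: code_graft; rewrite ?F2_add1 | apply: graft_eq0].
by move/eqP: f0.
Qed.

Lemma decodableU i (S : {set vertex i.+1}) :
  decodable L ([bseq] |: S) = decodable L S || deficient S.
Proof.
rewrite /deficient; case: (boolP (decodable L S)) => [dS|_]; last by rewrite andbT.
by rewrite (decodableW (subsetUr _ S) dS).
Qed.

Lemma deficientN i (S : {set vertex i}) : decodable L S -> deficient S = false.
Proof. by rewrite /deficient => ->; rewrite andbF. Qed.

(** Adding the root leaves both subtrees unchanged, so this compares the criteria for a present and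
    a missing root. *)
Lemma deficientE n b (S : {set vertex n.+2}) :
  deficient S = ([bseq] \notin S) &&
    ((deficient (subset_below b S) && decodable L (subset_below (~~ b) S)) ||
     (decodable L (subset_below b S) && deficient (subset_below (~~ b) S))).
Proof.
rewrite {1}/deficient; case: (boolP ([bseq] \in S)) => rS /=.
  by rewrite (setUidPr _) ?sub1set // andbN.
rewrite (decodable_root_present b) ?setU11 // (decodable_root_missing b) //.
rewrite !subset_belowU1 !decodableU.
have := @deficientN _ (subset_below b S).
have := @deficientN _ (subset_below (~~ b) S).
case: (decodable L (subset_below (~~ b) S)) => [/(_ isT) ->|_];
  case: (decodable L (subset_below b S)) => [/(_ isT) ->|_];
  by rewrite ?orbT ?orbF ?andbT ?andbF.
Qed.

(** The three alternatives exclude each other, since deficient sets are not decodable; hence their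
    probabilities add. *)
Lemma decodableE n b (S : {set vertex n.+2}) :
  decodable L S =
    (decodable L (subset_below b S) && decodable L (subset_below (~~ b) S)) ||
    ([bseq] \in S) &&
    ((deficient (subset_below b S) && decodable L (subset_below (~~ b) S)) ||
     (decodable L (subset_below b S) && deficient (subset_below (~~ b) S))).
Proof.
case: (boolP ([bseq] \in S)) => rS /=; last by rewrite orbF -decodable_root_missing.
rewrite (decodable_root_present b) // !decodableU.
by do 2![case: (decodable L _) => //=]; rewrite ?andbT ?andbF ?orbT ?orbF.
Qed.

End Decodable.

(** * Recovery by recursion on the tree, and tree automorphisms *)

Definition leaf_cons n b (y : leaf n.+1) : leaf n.+2 := [tuple of b :: y].

Lemma leaf_vertex_cons n b (y : leaf n.+1) :
  leaf_vertex (leaf_cons b y) = child b (leaf_vertex y).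
Proof. exact: val_inj. Qed.

Lemma prefix_child n b c (v w : vertex n.+1) :
  prefix (child b v) (child c w) = (b == c) && prefix v w.
Proof. exact: prefix_cons. Qed.

(** Its negation says that the whole path from the root to [y], both ends included, is missing. *)
Definition hit i (S : {set vertex i}) (y : leaf i) :=
  [exists w in S, prefix w (leaf_vertex y)].

Lemma hit1 (S : {set vertex 1}) (y : leaf 1) : hit S y = ([bseq] \in S).
Proof.
apply/exists_inP/idP => [[v vS _]|rS]; last by exists [bseq]; rewrite ?prefix0s.
by rewrite (_ : [bseq] = v) //; apply: val_inj; case: v {vS} => [[]].
Qed.

Lemma hit_cons n b (S : {set vertex n.+2}) (y : leaf n.+1) :
  hit S (leaf_cons b y) = ([bseq] \in S) || hit (subset_below b S) y.
Proof.
apply/exists_inP/orP => [[v]|[rS|/exists_inP[w]]].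
- rewrite leaf_vertex_cons; case: (vertexP v) => [->|[c [w ->]]]; first by left.
  rewrite prefix_child => wS /andP[/eqP cb pw]; right; apply/exists_inP.
  by exists w; rewrite // inE -cb.
- by exists [bseq]; rewrite ?prefix0s.
rewrite inE => wS pw; exists (child b w) => //.
by rewrite leaf_vertex_cons prefix_child eqxx.
Qed.

(** By induction: a decodable set contains the root or restricts to a decodable set in the subtree
    of [y]. *)
Lemma decodable_hit L n (S : {set vertex n.+1}) (y : leaf n.+1) : (0 < L)%N ->
  decodable L S -> hit S y.
Proof.
move=> hL; elim: n S y => [|n IH] S y; first by rewrite hit1 decodable1.
case/tupleP: y => b y; rewrite (decodableE hL b) (@hit_cons _ b).
case/orP => [/andP[/IH -> _]|/andP[-> //]]; exact: orbT.
Qed.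

Lemma child_inj n b : injective (@child n b).
Proof. by move=> v w /(congr1 val) [/val_inj]. Qed.

Lemma below_child n b c (x w : vertex n.+1) :
  below (child b x) (child c w) = (b == c) && below x w.
Proof.
rewrite /below prefix_child andbCA; case: eqVneq => //= <-.
by rewrite (inj_eq (@child_inj n b)).
Qed.

Lemma below_root n b (w : vertex n.+1) : below [bseq] (child b w).
Proof. by []. Qed.

Lemma below_childl n b (x : vertex n.+1) (w : vertex n.+2) :
  below (child b x) w -> exists2 w', w = child b w' & below x w'.
Proof.
case: (vertexP w) => [->|[c [w' ->]]].
  by [].
by rewrite below_child => /andP[/eqP <-]; exists w'.
Qed.

Lemma missing_path_below_child n b (S : {set vertex n.+2}) (x y : vertex n.+1) :
  missing_path_below S (child b x) (child b y) =
  missing_path_below (subset_below b S) x y.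
Proof.
rewrite /missing_path_below below_child eqxx /=; congr (_ && _).
apply/forallP/forallP => H w; apply/implyP => /andP[xw wy].
  rewrite inE; have /implyP -> // := H (child b w).
  by rewrite below_child eqxx xw /= eqxx.
have [w' ew xw'] := below_childl xw; have /implyP := H w'.
by rewrite inE ew => -> //; move: wy; rewrite ew /= eqxx xw'.
Qed.

Lemma card_communicated_child n b (S : {set vertex n.+2}) (x : vertex n.+1) :
  #|communicated S (child b x)| = #|communicated (subset_below b S) x|.
Proof.
rewrite -[RHS](card_imset _ (@child_inj n b)); apply: eq_card => z.
apply/idP/imsetP => [|[z' + ->]]; rewrite !inE => /and3P[zS xz nz].
  have [z' ez xz'] := below_childl xz; exists z' => //.
  rewrite !inE -ez zS xz'; apply: contra nz => /exists_inP[w].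
  rewrite inE => wS /andP[xw wz]; apply/exists_inP; exists (child b w) => //.
  by rewrite ez !below_child !eqxx xw.
rewrite zS below_child eqxx xz; apply: contra nz => /exists_inP[w wS /andP[xw wz]].
have [w' ew xw'] := below_childl xw; apply/exists_inP; exists w'; first by rewrite inE -ew.
by move: wz; rewrite ew below_child eqxx xw'.
Qed.

(** A present vertex on the path inside the subtree keeps the root from recovering [y], so recovery
    and its cost are those of the subtree. *)
Lemma recovered_with_child n b (S : {set vertex n.+2}) (y : leaf n.+1) N :
  hit (subset_below b S) y ->
  recovered_with S (leaf_cons b y) N = recovered_with (subset_below b S) y N.
Proof.
move=> /exists_inP[w]; rewrite inE => wS wy.
rewrite /recovered_with leaf_vertex_cons inE; case: ifP => // _.
apply/exists_inP/exists_inP => -[x xS /andP[mx cx]]; last first.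
  exists (child b x); first by rewrite inE in xS.
  by rewrite missing_path_below_child mx card_communicated_child.
move: xS mx cx; case: (vertexP x) => [->|[c [x' ->]]] xS.
  (* Recovery from the root is impossible, because [w] interrupts the missing path. *)
  move=> /andP[_ /forallP/(_ (child b w))]; rewrite below_root wS /=.
  by rewrite eqxx wy.
move=> mx; have := mx => /andP[]; rewrite below_child => /andP[/eqP cb _ _].
move: xS mx; rewrite {}cb missing_path_below_child card_communicated_child => xS mx cx.
by exists x'; rewrite ?inE // mx.
Qed.

(* Flipping the turns along m is an automorphism of the tree; it can move any
   leaf to any other one. *)
Fixpoint xor_seq (m s : seq bool) : seq bool :=
  if s is b :: s' then (b (+) head false m) :: xor_seq (behead m) s' else [::].

Lemma size_xor_seq m s : size (xor_seq m s) = size s.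
Proof. by elim: s m => //= b s IH m; rewrite IH. Qed.

Lemma xor_seqK m : involutive (xor_seq m).
Proof. by move=> s; elim: s m => //= b s IH m; rewrite IH addbK. Qed.

Lemma xor_seq_rcons m s b :
  xor_seq m (rcons s b) = rcons (xor_seq m s) (b (+) nth false m (size s)).
Proof.
by elim: s m => [|c s IH] [|d m] //=; rewrite IH //= nth_nil.
Qed.

Lemma prefix_xor_seq m s t : prefix (xor_seq m s) (xor_seq m t) = prefix s t.
Proof.
elim: s m t => [|b s IH] m [|c t] //=; rewrite IH.
by rewrite (inj_eq (@addIb _)).
Qed.

Lemma xor_seq_trans s t : size s = size t -> xor_seq (xor_seq s t) s = t.
Proof.
elim: s t => [|b s IH] [|c t] //= [/IH ->]; by rewrite addbC addbK.
Qed.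

Section Flip.
Variables (n : nat) (m : seq bool).
Implicit Types (S : {set vertex n.+1}) (v w : vertex n.+1).

Lemma size_flip v : (size (xor_seq m v) <= n)%N.
Proof. by rewrite size_xor_seq size_bseq. Qed.

Definition flip v : vertex n.+1 := Bseq (size_flip v).
Definition flip_set S := flip @^-1: S.

Lemma flipK : involutive flip.
Proof. by move=> v; apply: val_inj; rewrite /= xor_seqK. Qed.

Lemma flip_setK : involutive flip_set.
Proof. by move=> S; apply/setP => v; rewrite !inE flipK. Qed.

Lemma below_flip v w : below (flip v) (flip w) = below v w.
Proof. by rewrite /below (inj_eq (inv_inj flipK)) prefix_xor_seq. Qed.

Lemma decodable_flip L S : (0 < L)%N -> decodable L (flip_set S) = decodable L S.
Proof.
move=> hL.
suff imp S' : decodable L (flip_set S') -> decodable L S'.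
  by apply/idP/idP => [/imp //|dS]; apply: imp; rewrite flip_setK.
move=> /(decodableP _ hL) H; apply/decodableP => // f cf fS s ss.
rewrite -[s](xor_seqK m); apply: (H (fun s => f (xor_seq m s))).
- move=> t st; rewrite cf ?size_xor_seq // !xor_seq_rcons.
  by case: (nth _ _ _) => //=; rewrite addrC.
- by move=> v; rewrite inE => /fS.
by rewrite size_xor_seq.
Qed.

Lemma exists_flip (P : pred (vertex n.+1)) : [exists v, P (flip v)] = [exists v, P v].
Proof.
apply/existsP/existsP => -[v Pv]; first by exists (flip v).
by exists (flip v); rewrite flipK.
Qed.

Lemma missing_path_below_flip S x y :
  missing_path_below (flip_set S) x y = missing_path_below S (flip x) (flip y).
Proof.
rewrite /missing_path_below below_flip; congr (_ && _).
apply/forallP/forallP => H w; apply/implyP => /andP[xw wy].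
  have /implyP := H (flip w); rewrite inE flipK; apply.
  by rewrite -below_flip flipK xw -(prefix_xor_seq m) xor_seqK.
have /implyP := H (flip w); rewrite inE; apply.
by rewrite below_flip xw prefix_xor_seq.
Qed.

Lemma card_communicated_flip S x :
  #|communicated (flip_set S) x| = #|communicated S (flip x)|.
Proof.
have -> : communicated (flip_set S) x = flip @^-1: communicated S (flip x).
  apply/setP => z; rewrite !inE below_flip; congr [&& _, _ & ~~ _].
  rewrite -[RHS]exists_flip; apply: eq_existsb => w.
  by rewrite inE !below_flip.
by rewrite on_card_preimset //; apply: onW_bij; exists flip; apply: flipK.
Qed.

Lemma recovered_with_flip S (y z : leaf n.+1) N : xor_seq m y = z ->
  recovered_with (flip_set S) y N = recovered_with S z N.
Proof.
move=> yz; have {}yz : leaf_vertex z = flip (leaf_vertex y) by apply: val_inj.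
rewrite /recovered_with yz inE; case: ifP => // _.
rewrite -[RHS]exists_flip; apply: eq_existsb => x.
by rewrite inE missing_path_below_flip card_communicated_flip.
Qed.

End Flip.

(** * Probabilities of random subsets *)

(** Inverse of splitting a subset into the status of the root and the two subtree subsets; it
    supplies the bijection for [prob_vertex]. *)
Definition join_sets n b (A B : {set vertex n.+1}) (c : bool) : {set vertex n.+2} :=
  (if c then [set [bseq]] else set0) :|:
  (child b @: A :|: child (~~ b) @: B).

Lemma mem_child n b c (A : {set vertex n.+1}) v :
  (child c v \in child b @: A) = (b == c) && (v \in A).
Proof.
apply/imsetP/andP => [[w wA e]|[/eqP <- vA]]; last by exists v.
have [bc] := congr1 (fun u : vertex n.+2 => bseqval u) e => vw.
by rewrite bc eqxx (_ : v = w) //; apply: val_inj.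
Qed.

Lemma root_notin_child n b (A : {set vertex n.+1}) : ([bseq] \in child b @: A) = false.
Proof. by apply/imsetP => -[w _ /(congr1 val)]. Qed.

Lemma root_join n b (A B : {set vertex n.+1}) c : ([bseq] \in join_sets b A B c) = c.
Proof. by case: c; rewrite !inE ?eqxx ?root_notin_child. Qed.

Lemma child_join n b (A B : {set vertex n.+1}) c :
  subset_below b (join_sets b A B c) = A.
Proof.
apply/setP => v; rewrite !inE !mem_child eqxx eqb_negLR.
by case: b c => [] []; rewrite ?inE ?child_neq0 //= orbF.
Qed.

Lemma childN_join n b (A B : {set vertex n.+1}) c :
  subset_below (~~ b) (join_sets b A B c) = B.
Proof.
apply/setP => v; rewrite !inE !mem_child eqxx.
by case: b c => [] []; rewrite ?inE ?child_neq0.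
Qed.

Lemma joinE n b (S : {set vertex n.+2}) :
  join_sets b (subset_below b S) (subset_below (~~ b) S) ([bseq] \in S) = S.
Proof.
apply/setP => v; case: (vertexP v) => [->|[c [w ->]]]; first by rewrite root_join.
have e (T : {set vertex n.+2}) : (child c w \in T) = (w \in subset_below c T) by rewrite inE.
by rewrite !e; case: (eqVneq c b) => [->|/negb_neq <-]; rewrite ?child_join ?childN_join.
Qed.

Section Prob.
Variable R : realFieldType.

Lemma prod_vertex n b (F : vertex n.+2 -> R) :
  \prod_v F v =
  F [bseq] * (\prod_(v : vertex n.+1) F (child b v) *
              \prod_(v : vertex n.+1) F (child (~~ b) v)).
Proof.
rewrite (bigD1 [bseq]) //=; congr (_ * _).
rewrite (bigID (mem (child b @: [set: vertex n.+1]))) /=; congr (_ * _).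
  rewrite (eq_bigl (fun v => v \in child b @: [set: vertex n.+1])) /=.
    rewrite big_imset /=; last by move=> ? ? _ _; apply: child_inj.
    by apply: eq_bigl => v; rewrite inE.
  by move=> v; case: (vertexP v) => [->|[c [w ->]]]; rewrite ?eqxx ?root_notin_child ?child_neq0.
rewrite (eq_bigl (fun v => v \in child (~~ b) @: [set: vertex n.+1])) /=.
  rewrite big_imset /=; last by move=> ? ? _ _; apply: child_inj.
  by apply: eq_bigl => v; rewrite inE.
move=> v; case: (vertexP v) => [->|[c [w ->]]]; rewrite ?eqxx ?root_notin_child //.
by rewrite child_neq0 !mem_child !inE !andbT; case: b c => [] [].
Qed.

Lemma eq_prob (V : finType) (q q' : V -> R) (E E' : pred {set V}) :
  q =1 q' -> E =1 E' -> prob_subset q E = prob_subset q' E'.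
Proof.
move=> eq eE; apply: eq_big => // S _; apply: eq_bigr => v _; by rewrite eq.
Qed.

Lemma probE (V : finType) (q : V -> R) (E : pred {set V}) :
  prob_subset q E =
  \sum_(S : {set V}) (E S)%:R * \prod_(v : V) (if v \in S then q v else 1 - q v).
Proof.
by rewrite /prob_subset big_mkcond; apply: eq_bigr => S _; case: (E S); rewrite ?mul1r ?mul0r.
Qed.

(** Adding indicators as numbers expresses that [E] is the disjoint union of [F] and [G]. *)
Lemma probD (V : finType) (q : V -> R) (E F G : pred {set V}) :
  (forall S, E S = F S + G S :> nat)%N ->
  prob_subset q E = prob_subset q F + prob_subset q G.
Proof.
by move=> e; rewrite !probE -big_split; apply: eq_bigr => S _; rewrite e natrD mulrDl.
Qed.

(** Independence of the root and the two subtrees; the first factor is the probability that the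
    status of the root satisfies [C]. *)
Lemma prob_vertex n b (q : vertex n.+2 -> R) (C : pred bool) (E1 E2 : pred {set vertex n.+1}) :
  prob_subset q (fun S => C ([bseq] \in S) &&
     (E1 (subset_below b S) && E2 (subset_below (~~ b) S))) =
  ((C true)%:R * q [bseq] + (C false)%:R * (1 - q [bseq])) *
  (prob_subset (fun v => q (child b v)) E1 *
   prob_subset (fun v => q (child (~~ b) v)) E2).
Proof.
pose W (T : finType) (r : T -> R) (S : {set T}) := \prod_v (if v \in S then r v else 1 - r v).
rewrite {1}/prob_subset.
rewrite (reindex (fun x : bool * ({set vertex n.+1} * {set vertex n.+1}) =>
   join_sets b x.2.1 x.2.2 x.1)); last first.
  exists (fun S : {set vertex n.+2} =>
    ([bseq] \in S, (subset_below b S, subset_below (~~ b) S))) => /=.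
    by move=> [c [A B]] _; rewrite root_join child_join childN_join.
  by move=> S _; rewrite joinE.
transitivity (\sum_(x : bool * ({set vertex n.+1} * {set vertex n.+1})
     | C x.1 && (E1 x.2.1 && E2 x.2.2))
   (if x.1 then q [bseq] else 1 - q [bseq]) *
   (W _ (fun v => q (child b v)) x.2.1 * W _ (fun v => q (child (~~ b) v)) x.2.2)).
  apply: eq_big => [[c [A B]]|[c [A B]] _] /=.
    by rewrite root_join child_join childN_join.
  rewrite (prod_vertex b) root_join; congr (_ * (_ * _)); apply: eq_bigr => v _.
    by have /setP/(_ v) := child_join b A B c; rewrite inE => ->.
  by have /setP/(_ v) := childN_join b A B c; rewrite inE => ->.
rewrite -(pair_big (fun c => C c) (fun y => E1 y.1 && E2 y.2) (fun c y =>
   (if c then q [bseq] else 1 - q [bseq]) *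
   (W _ (fun v => q (child b v)) y.1 * W _ (fun v => q (child (~~ b) v)) y.2))) /=.
rewrite (eq_bigr (fun c : bool => (if c then q [bseq] else 1 - q [bseq]) *
  (prob_subset (fun v => q (child b v)) E1 *
   prob_subset (fun v => q (child (~~ b) v)) E2))); last first.
  move=> c _; rewrite -mulr_sumr; congr (_ * _).
  by rewrite /prob_subset big_distrlr pair_big.
rewrite -mulr_suml big_mkcond big_bool; congr (_ * _).
by congr (_ + _); case: (C _); rewrite ?mul1r ?mul0r.
Qed.

Lemma prob_singleton (V : finType) (q : V -> R) (v0 : V) (C : pred bool) :
  (forall v, v = v0) ->
  prob_subset q (fun S => C (v0 \in S)) =
  (C true)%:R * q v0 + (C false)%:R * (1 - q v0).
Proof.
move=> V1; rewrite probE.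
have W S : \prod_v (if v \in S then q v else 1 - q v) = if v0 \in S then q v0 else 1 - q v0.
  by rewrite (bigD1 v0) //= big1 ?mulr1 // => v; rewrite (V1 v) eqxx.
have mem c : (v0 \in [set v : V | c]) = c by rewrite inE.
rewrite (reindex (fun c : bool => [set v : V | c])) /=.
  by rewrite big_bool !W !mem.
exists (fun S : {set V} => v0 \in S) => [c _|S _]; first exact: mem.
by apply/setP => v; rewrite inE (V1 v).
Qed.

Lemma prob_flip n m (q : vertex n.+1 -> R) (E : pred {set vertex n.+1}) :
  prob_subset q E = prob_subset (q \o @flip n m) (E \o @flip_set n m).
Proof.
rewrite /prob_subset (reindex_inj (inv_inj (@flip_setK n m))) /=.
apply: eq_bigr => S _; rewrite (reindex_inj (inv_inj (@flipK n m))) /=.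
by apply: eq_bigr => v _; rewrite inE flipK.
Qed.

(** A path from the root to a leaf has exactly one vertex in each layer. *)
Lemma prod_prefix n (y : leaf n.+1) (f : nat -> R) :
  \prod_(v : vertex n.+1 | prefix v (leaf_vertex y)) f (layer v) =
  \prod_(1 <= l < n.+2) f l.
Proof.
elim: n y => [|n IH] y.
  rewrite big_nat1 (big_pred1 [bseq]) // => v.
  by rewrite /= (_ : v = [bseq]) ?eqxx ?prefix0s //; apply: val_inj; case: v => [[]].
case/tupleP: y => b y; rewrite big_nat_recr //= -(IH y) big_mkcond (prod_vertex b).
rewrite mulrC; congr (_ * _); rewrite [X in _ * X]big1 ?mulr1.
  by rewrite [RHS]big_mkcond; apply: eq_bigr => v _; rewrite /layer /= eqxx subSS.
by move=> v _ /=; case: (b).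
Qed.

Variables (L : nat) (hL : (0 < L)%N) (p : nat -> R).

(** The two laws are compared subset by subset. No division occurs, so the identity also covers a
    conditioning event of probability 0. *)
Lemma prob_missing_path n b (y : leaf n.+1) (E : pred {set vertex n.+2}) :
  prob_subset (@layer_law R p n.+2)
    (fun S => [&& [bseq] \in S, ~~ hit (subset_below b S) y & E S]) =
  p n.+2 * \prod_(1 <= l < n.+2) (1 - p l) *
  prob_subset (missing_path_law p (leaf_cons b y)) E.
Proof.
rewrite !probE mulr_sumr; apply: eq_bigr => S _.
rewrite andbA andbC -mulnb natrM -mulrA [RHS]mulrCA; congr (_ * _).
rewrite !(prod_vertex b) /missing_path_law /= -(prod_prefix y).
(* With the root missing, the left indicator is 0 and the conditioned law contributes 1 - 1 = 0. *)
case: (boolP ([bseq] \in S)) => rS /=; last by rewrite !(mulr0, mul0r, subrr).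
have lE c (v : vertex n.+1) : layer (child c v) = layer v by rewrite /layer /= subSS.
(* [Wb] and [Wn] are the weights of the subtrees with and without [y]; primes mark the conditioned
   law, which alters only [Wb]. *)
set Wn := (X in _ * (_ * (_ * X))); set Wb := (X in _ * (_ * (X * _))).
set Wn' := (X in _ = _ * (_ * (_ * X))); set Wb' := (X in _ = _ * (_ * (X * _))).
have -> : Wn' = Wn.
  apply: eq_bigr => v _; rewrite (_ : (~~ b == b) = false) //; by case: (b).
suff e : (~~ hit (subset_below b S) y)%:R * Wb =
    \prod_(v : vertex n.+1 | prefix v (leaf_vertex y)) (1 - p (layer v)) * Wb'.
  by rewrite mul1r [LHS]mulrCA -[RHS]mulrA; congr (_ * _); rewrite !mulrA; congr (_ * _).
case: (boolP (hit _ _)) => [/exists_inP[w]|nh].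
  (* A present vertex [w] on the path has conditioned probability 0, which makes [Wb'] vanish. *)
  rewrite inE mul0r => wS wy; rewrite (_ : Wb' = 0) ?mulr0 //.
  rewrite /Wb' (bigD1 w) //= wS ifT ?mul0r // eqxx.
  exact: wy.
rewrite mul1r big_mkcond -big_split /=; apply: eq_bigr => v _.
rewrite eqxx /= /layer_law !lE.
case: (boolP (prefix v y)) => vy; last by rewrite mul1r.
case: ifP => vS; last by rewrite subr0 mulr1.
by case/negP: nh; apply/exists_inP; exists v; rewrite ?inE.
Qed.


Lemma layer_law_child n b (v : vertex n.+1) :
  layer_law p (child b v) = layer_law p v.
Proof. by rewrite /layer_law /layer /= subSS. Qed.

Lemma prob_layer n b (C : pred bool) (E1 E2 : pred {set vertex n.+1}) :
  prob_subset (@layer_law R p n.+2) (fun S => C ([bseq] \in S) &&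
     (E1 (subset_below b S) && E2 (subset_below (~~ b) S))) =
  ((C true)%:R * p n.+2 + (C false)%:R * (1 - p n.+2)) *
  (prob_subset (@layer_law R p n.+1) E1 * prob_subset (@layer_law R p n.+1) E2).
Proof.
rewrite (prob_vertex b); congr (_ * (_ * _)); apply: eq_prob => // v; exact: layer_law_child.
Qed.

End Prob.

(** * The recurrence *)

Section Recursion.
Variables (R : realFieldType) (L : nat) (hL : (0 < L)%N) (p : nat -> R).

Lemma layer_law_flip n m (v : vertex n.+1) :
  layer_law p (flip m v) = layer_law p v.
Proof. by rewrite /layer_law /layer /= size_xor_seq. Qed.

Lemma Pprob_leaf n (y z : leaf n.+1) N : Pprob L p n.+1 y N = Pprob L p n.+1 z N.
Proof.
rewrite /Pprob (prob_flip (xor_seq y z)); apply: eq_prob => [v|S] /=.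
  exact: layer_law_flip.
rewrite decodable_flip // (recovered_with_flip _ _ (z := z)) //.
by rewrite xor_seq_trans ?size_tuple.
Qed.

(** The law itself depends on the leaf here, but the flip carries it along. *)
Lemma Aprob_leaf n (y z : leaf n.+1) N : Aprob L p n.+1 y N = Aprob L p n.+1 z N.
Proof.
have := xor_seq_trans (etrans (size_tuple y) (esym (size_tuple z))).
move: (xor_seq y z) => m yz.
rewrite /Aprob [RHS](prob_flip m); apply: eq_prob => [v|S] /=; last first.
  rewrite decodable_flip // (recovered_with_flip _ _ (z := y)) //.
  by rewrite -yz xor_seqK.
rewrite /missing_path_law /layer /= size_xor_seq -yz prefix_xor_seq.
by congr (if _ then _ else _); case: v => [[]].
Qed.

(** The index is the depth: [Eprob n] refers to the tree with [n.+1] layers. *)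
Definition Eprob n : R := prob_subset (@layer_law R p n.+1) (@deficient L n.+1).

(* The missing path of a deficient set ends at y iff S contains no vertex on
   the path to y, so hit excludes that case. *)
Definition Gprob n (y : leaf n.+1) N : R :=
  prob_subset (@layer_law R p n.+1)
    (fun S => deficient L S && (hit S y && recovered_with S y N)).

Lemma Eprob0 : Eprob 0 = 1 - p 1%N.
Proof.
rewrite /Eprob (eq_prob (E' := fun S => ~~ ([bseq] \in S)) (frefl _)); last first.
  by move=> S; rewrite deficient1.
rewrite (prob_singleton _ negb); first by rewrite mul0r mul1r add0r.
by move=> v; apply: val_inj; case: v => [[]].
Qed.

(** Either subtree may be the deficient one; symmetry gives the factor 2. *)
Lemma EprobS n : Eprob n.+1 = (1 - p n.+2) * (2 * Eprob n * Qprob L p n.+1).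
Proof.
rewrite /Eprob (@probD _ _ _ _
  (fun S => ~~ ([bseq] \in S) &&
    (deficient L (subset_below true S) && decodable L (subset_below false S)))
  (fun S => ~~ ([bseq] \in S) &&
    (decodable L (subset_below true S) && deficient L (subset_below false S)))).
  rewrite (prob_layer _ true negb (@deficient L _) (@decodable _ L)).
  rewrite (prob_layer _ true negb (@decodable _ L) (@deficient L _)) /Qprob /=.
  by ring.
move=> S; rewrite (deficientE hL true) /=.
have := @deficientN L _ (subset_below true S).
by case: (decodable L (subset_below true S)) => [/(_ isT) ->|_];
  case: ([bseq] \in S); rewrite /= ?andbF ?orbF ?addn0.
Qed.

Lemma Gprob0 (y : leaf 1) N : Gprob y N = 0.
Proof.
rewrite /Gprob /prob_subset big_pred0 // => S.
by rewrite hit1 deficient1 //; case: (_ \in _).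
Qed.

(** The missing path runs either in the subtree of [y], without ending at [y], or in the other one;
    then the subtree of [y] is decodable and a hit is automatic. *)
Lemma GprobS n b (y : leaf n.+1) N :
  Gprob (leaf_cons b y) N =
  (1 - p n.+2) * (Gprob y N * Qprob L p n.+1 + Pprob L p n.+1 y N * Eprob n).
Proof.
rewrite /Gprob (@probD _ _ _ _
  (fun S => ~~ ([bseq] \in S) && ((deficient L (subset_below b S) &&
      (hit (subset_below b S) y && recovered_with (subset_below b S) y N)) &&
      decodable L (subset_below (~~ b) S)))
  (fun S => ~~ ([bseq] \in S) && ((decodable L (subset_below b S) &&
      recovered_with (subset_below b S) y N) && deficient L (subset_below (~~ b) S)))).
  rewrite (prob_layer _ b negb (fun T => deficient L T && (hit T y && recovered_with T y N))
     (@decodable _ L)).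
  rewrite (prob_layer _ b negb (fun T => decodable L T && recovered_with T y N)
     (@deficient L _)) /Qprob /Pprob /Eprob /=.
  by ring.
move=> S; rewrite (deficientE hL b) hit_cons.
case: ([bseq] \in S) => //=.
have := @deficientN L _ (subset_below b S).
have := @decodable_hit L _ (subset_below b S) y hL.
have := @recovered_with_child _ b S y N.
case: (decodable L (subset_below b S)) => [r /(_ isT) h /(_ isT) ->|+ _ _].
  by rewrite h r //=; do ![case: (recovered_with _ _ _) | case: (deficient _ _)].
case: (hit _ _) => [/(_ isT) -> |_]; rewrite /= ?andbF ?orbF ?addn0 //.
by rewrite andbAC.
Qed.

Lemma PprobS n b (y : leaf n.+1) N :
  Pprob L p n.+2 (leaf_cons b y) N =
  Qprob L p n.+1 * Pprob L p n.+1 y N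
  + p n.+2 * (Pprob L p n.+1 y N * Eprob n + Qprob L p n.+1 * Gprob y N)
  + p n.+2 * \prod_(1 <= l < n.+2) (1 - p l) * Aprob L p n.+2 (leaf_cons b y) N.
Proof.
pose F1 S := decodable L S && recovered_with (i := n.+1) S y N.
pose F3 S := deficient L S && (hit (i := n.+1) S y && recovered_with S y N).
(* [E1]: both subtrees are decodable. [E2], [E3]: the root fills a missing path in the other
   subtree, or in that of [y] but ending at another leaf. In these three [y] is recovered inside its
   subtree. [E4]: the path to [y] itself is missing. *)
pose E1 (S : {set vertex n.+2}) :=
  true && (F1 (subset_below b S) && decodable L (subset_below (~~ b) S)).
pose E2 (S : {set vertex n.+2}) :=
  ([bseq] \in S) && (F1 (subset_below b S) && deficient L (subset_below (~~ b) S)).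
pose E3 (S : {set vertex n.+2}) :=
  ([bseq] \in S) && (F3 (subset_below b S) && decodable L (subset_below (~~ b) S)).
pose E4 (S : {set vertex n.+2}) := [&& [bseq] \in S, ~~ hit (subset_below b S) y &
   decodable L S && recovered_with S (leaf_cons b y) N].
rewrite /Aprob -prob_missing_path /Pprob.
rewrite (@probD _ _ _ _ (fun S => E1 S || (E2 S || E3 S)) E4); last first.
  move=> S; rewrite /E1 /E2 /E3 /E4 /F1 /F3 (decodableE hL b).
  have := @deficientN L _ (subset_below b S).
  have := @decodable_hit L _ (subset_below b S) y hL.
  have := @recovered_with_child _ b S y N.
  case: (decodable L (subset_below b S)) => [r /(_ isT) h /(_ isT) ->|+ _ _].
    rewrite h r //= andbF addn0 orbF.
    by case: (decodable _ _) (deficient _ _) ([bseq] \in S) (recovered_with _ _ _) => [] [] [] [].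
  case: (hit _ _) => [/(_ isT) -> |_] /=;
  by case: (decodable _ _) (deficient _ _) ([bseq] \in S) (recovered_with _ _ _) => [] [] [] [].
rewrite (@probD _ _ _ _ E1 (fun S => E2 S || E3 S)); last first.
  move=> S; rewrite /E1 /E2 /E3 /F1 /F3.
  have := @deficientN L _ (subset_below b S).
  have := @deficientN L _ (subset_below (~~ b) S).
  case: (decodable L (subset_below (~~ b) S)) => [/(_ isT) ->|_];
  case: (decodable L (subset_below b S)) => [/(_ isT) ->|_]; 
  by rewrite ?(andbF, andbT, orbF, addn0).
rewrite (@probD _ _ _ (fun S => E2 S || E3 S) E2 E3); last first.
  move=> S; rewrite /E2 /E3 /F1 /F3.
  have := @deficientN L _ (subset_below b S).
  by case: (decodable L (subset_below b S)) => [/(_ isT) ->|_]; rewrite /= ?(andbF, orbF) /= ?addn0.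
rewrite (prob_layer _ b xpredT F1 (@decodable _ L)).
rewrite (prob_layer _ b id F1 (@deficient L _)).
rewrite (prob_layer _ b id F3 (@decodable _ L)) /=.
by rewrite /Qprob /Eprob /Gprob -/F1 -/F3; ring.
Qed.

(** The missing path meets every layer and ends at one of [2 ^ n] leaves; one decodable subtree of
    each height from 1 to [n] hangs off it. *)
Lemma EprobE n : Eprob n =
  \prod_(1 <= l < n.+2) (1 - p l) * (2 ^+ n * \prod_(1 <= l < n.+1) Qprob L p l).
Proof.
elim: n => [|n IH]; first by rewrite Eprob0 big_nat1 big_geq // !mulr1.
by rewrite EprobS IH exprS !(big_nat_recr n.+2) //= !(big_nat_recr n.+1) //=; ring.
Qed.

(* The right-hand side adds up over the layer j of the subtree that contains u and
   hangs off a missing path of T_(n+2) from a child of the root to a leaf other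
   than u: the first term on the left is the case where that path avoids T_(n+1),
   the second the case where it runs inside T_(n+1). *)
Lemma recovery_off_path (y : forall i, leaf i) n (u : leaf n.+1) N :
  Pprob L p n.+1 u N * Eprob n + Qprob L p n.+1 * Gprob u N =
  \prod_(1 <= l < n.+2) (1 - p l) *
  \sum_(1 <= j < n.+2) (2 ^+ j.-1 * Pprob L p j (y j) N *
     \prod_(1 <= l < n.+2 | l != j) Qprob L p l).
Proof.
elim: n u => [|n IH] u.
  by rewrite Eprob0 Gprob0 !big_nat1 big_mkcond big_nat1 eqxx /=
    (Pprob_leaf u (y 1%N)) mulr0 addr0 mul1r mulr1 mulrC.
case/tupleP: u => b u.
have := IH u; set T := (X in _ = _ * X) => {}IH.
rewrite [X in _ = _ * X]big_nat_recr //=.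
(* For the old values of [j] the product merely gains the factor with index [n.+2]. *)
have -> : \sum_(1 <= j < n.+2) (2 ^+ j.-1 * Pprob L p j (y j) N *
     \prod_(1 <= l < n.+3 | l != j) Qprob L p l) = T * Qprob L p n.+2.
  rewrite mulr_suml; apply: eq_big_nat => j /andP[_ lj].
  rewrite -[RHS]mulrA; congr (_ * _).
  by rewrite [LHS]big_mkcond big_nat_recr //= -big_mkcond gtn_eqF.
have -> : \prod_(1 <= l < n.+3 | l != n.+2) Qprob L p l = \prod_(1 <= l < n.+2) Qprob L p l.
  rewrite big_mkcond big_nat_recr //= eqxx mulr1; apply: eq_big_nat => l /andP[_ ll].
  by rewrite ltn_eqF.
(* By [EprobE] the first summand is the new term [j = n.+2]; the bracket from [GprobS] is the
   induction hypothesis with its terms swapped. *)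
rewrite (Pprob_leaf _ (y n.+2)) EprobE GprobS.
rewrite [Gprob u N * _]mulrC [_ + Pprob L p n.+1 u N * _]addrC IH.
by rewrite !(big_nat_recr n.+2) //=; ring.
Qed.

Lemma Pprob1 (y : leaf 1) N : Pprob L p 1 y N = if N == 0%N then p 1%N else 0.
Proof.
rewrite /Pprob (eq_prob (E' := fun S => ([bseq] \in S) && (N == 0%N)) (frefl _)); last first.
  move=> S; rewrite decodable1 //; case: (boolP ([bseq] \in S)) => //= rS.
  rewrite /recovered_with (_ : leaf_vertex y = [bseq]) ?rS //.
  by apply: val_inj; case: y => [[]].
rewrite (prob_singleton _ (fun c => c && (N == 0%N))).
  by rewrite /= mul0r addr0; case: eqP; rewrite ?mul1r ?mul0r.
by move=> v; apply: val_inj; case: v => [[]].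
Qed.

End Recursion.

(* y i and z i are the data fragments of T_i chosen in P_i(N) and A_i(N). *)
Theorem lemma19 (R : realFieldType) (L : nat) (p : nat -> R)
    (y z : forall i : nat, leaf i) (hL : (0 < L)%N)
    (hp : forall j : nat, (0 < j)%N -> 0 <= p j <= 1) :
  (forall i N : nat, (1 < i)%N ->
     Pprob L p i (y i) N =
       Qprob L p i.-1 * Pprob L p i.-1 (y i.-1) N
       + Aprob L p i (z i) N * p i * \prod_(1 <= l < i) (1 - p l)
       + p i * (\prod_(1 <= l < i) (1 - p l)) *
         \sum_(1 <= j < i)
           (2 ^+ j.-1 * Pprob L p j (y j) N *
            \prod_(1 <= l < i | l != j) Qprob L p l))
  /\ Pprob L p 1 (y 1%N) 0 = p 1%N
  /\ (forall N : nat, (0 < N)%N -> Pprob L p 1 (y 1%N) N = 0).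
Proof.
split; last by split => [|[|N] //]; rewrite Pprob1.
move=> [|[|n]] N // _; case/tupleP: (y n.+2) => b u.
(* The bracket in [PprobS] is the left side of [recovery_off_path]; symmetry then exchanges the
   leaves. *)
rewrite (PprobS hL p b u) (recovery_off_path hL p y).
rewrite (Aprob_leaf hL p _ (z n.+2)) (Pprob_leaf hL p u (y n.+1)) /=; ring.
Qed.
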